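(* Let $a,b,p,q$ be complex numbers with $p\neq 0$, $q\neq 0$, and let $(W_j)$, $(U_j)$, $(V_j)$ be as defined in the context. For a non-negative integer $n$ and any integers $m$ and $t$, \[ q^{mn}\sum_{k = 0}^n \binom {n + k}{k}\frac{W_{mk + t}}{V_m^k} = V_m^n W_{mn + t} - V_m^nU_m\big( W_{m(n + 1) + t + 1} - qW_{m(n + 1) + t - 1} \big)\sum_{k = 0}^{n - 1} \binom {2k + 1}{k}\frac{q^{mk}}{V_m^{2(k + 1)}} . \]
   Context: The Horadam sequence $W_j=W_j(a,b;p,q)$ is defined by $W_0=a$, $W_1=b$, $W_j=pW_{j-1}-qW_{j-2}$ for $j\ge 2$, and extended to negative indices by $W_{-j}=\frac{1}{q}(pW_{-j+1}-W_{-j+2})$. The Lucas sequences are $U_j=W_j(0,1;p,q)$ and $V_j=W_j(2,p;p,q)$. *)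

(* Defs.v *)
From mathcomp Require Export all_boot all_order all_algebra.
From mathcomp Require Export reals.
From mathcomp.real_closed Require Export complex.

Set Implicit Arguments.
Unset Strict Implicit.
Unset Printing Implicit Defensive.

Import GRing.Theory.

Local Open Scope ring_scope.

Fixpoint horadam_pos (F : fieldType) (a b p q : F) (j : nat) : F :=
  match j with
  | 0 => a
  | 1 => b
  | (j''.+1 as j').+1 =>
      p * horadam_pos a b p q j' - q * horadam_pos a b p q j''
  end.

(* [horadam_neg a b p q j] is W_{-j}, i.e.
   W_{-j} = q^-1 (p W_{-(j-1)} - W_{-(j-2)}); for j = 1 the term W_{-(j-2)}
   is W_1 = b. *)
Fixpoint horadam_neg (F : fieldType) (a b p q : F) (j : nat) : F :=
  match j with
  | 0 => a
  | 1 => q^-1 * (p * a - b)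
  | (j''.+1 as j').+1 =>
      q^-1 * (p * horadam_neg a b p q j' - horadam_neg a b p q j'')
  end.

(* Recall that [Negz j] is the integer -(j+1). *)
Definition horadam (F : fieldType) (a b p q : F) (j : int) : F :=
  match j with
  | Posz j => horadam_pos a b p q j
  | Negz j => horadam_neg a b p q j.+1
  end.

Definition lucasU (F : fieldType) (p q : F) : int -> F := horadam 0 1 p q.

Definition lucasV (F : fieldType) (p q : F) : int -> F := horadam 2 p p q.

Lemma horadam_rec (F : fieldType) (a b p q : F) (j : nat) : (2 <= j)%N ->
  horadam a b p q j%:Z =
    p * horadam a b p q (j%:Z - 1) - q * horadam a b p q (j%:Z - 2).
Proof.
case: j => [|[|j]] // _.
have -> : j.+2%:Z - 1 = j.+1%:Z by rewrite subzn // subn1.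
have -> : j.+2%:Z - 2 = j%:Z by rewrite subzn // subn2.
by [].
Qed.

Lemma horadam_recN (F : fieldType) (a b p q : F) (j : nat) : (1 <= j)%N ->
  horadam a b p q (- j%:Z) =
    q^-1 * (p * horadam a b p q (- j%:Z + 1) - horadam a b p q (- j%:Z + 2)).
Proof.
have negE k : horadam a b p q (- k%:Z) = horadam_neg a b p q k by case: k.
case: j => [|[|j]] // _.
have -> : - j.+2%:Z + 1 = - j.+1%:Z by rewrite (intS j.+1) opprD addrAC addNr add0r.
have -> : - j.+2%:Z + 2 = - j%:Z by rewrite -addn2 PoszD opprD addrNK.
by rewrite !negE.
Qed.

(* Main.v *)
(** Dividing by powers of [V_m] turns the [m]-step subsequence into
    [u_k = W_{mk+t} / V_m^k], which satisfies [u_{k+2} = u_{k+1} - z u_k] with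
    [z = q^m / V_m^2]. For [T_n(u) = \sum_(k <= n) 'C(n + k, k) u_k], Pascal's
    rule gives
    [T_{n+1}(u - Eu) = T_n(u) + 'C(2n + 1, n) (u_{n+1} - 2 u_{n+2})], [E] being
    the shift. Applied to [Eu], for which [Eu - E^2 u = z u], this expresses
    [z T_{n+1}(u)] through [T_n(Eu)], and the identity follows by induction. *)
Require Import Defs.
From mathcomp Require Import all_boot all_order all_algebra.
From mathcomp Require Import reals.
From mathcomp.real_closed Require Import complex.
From mathcomp Require Import zify ring.

Set Implicit Arguments.
Unset Strict Implicit.
Unset Printing Implicit Defensive.

Import GRing.Theory.

Local Open Scope ring_scope.

Section PascalSum.
Variable R : comNzRingType.
Implicit Types (u : nat -> R) (z : R) (n : nat).

Lemma sum_bin_diff u n :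
  \sum_(0 <= k < n.+2) 'C(n.+1 + k, k)%:R * (u k - u k.+1)
  = \sum_(0 <= k < n.+1) 'C(n + k, k)%:R * u k
    + 'C(2 * n + 1, n)%:R * (u n.+1 - 2 * u n.+2).
Proof.
have pascal : \sum_(0 <= k < n.+2) 'C(n.+1 + k, k)%:R * u k
    = \sum_(0 <= k < n.+2) 'C(n + k, k)%:R * u k
      + \sum_(0 <= k < n.+1) 'C(n.+1 + k, k)%:R * u k.+1.
  rewrite big_nat_recl // [X in _ = X + _]big_nat_recl // -addrA -big_split /=.
  rewrite !addn0 !bin0; congr (_ + _); apply: eq_bigr => k _.
  by rewrite addSn binS natrD addSnnS mulrDl.
under eq_bigr do rewrite mulrBr.
(* Only the top terms survive the cancellation; ['C(2n+2, n+1) = 2 'C(2n+1, n)] produces the factor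
   2. *)
rewrite sumrB pascal big_nat_recr //= [X in _ - X]big_nat_recr //=.
have -> : (n + n.+1 = 2 * n + 1)%N by lia.
have -> : (n.+1 + n.+1 = (2 * n + 1).+1)%N by lia.
have mid : 'C(2 * n + 1, n.+1) = 'C(2 * n + 1, n).
  by rewrite -bin_sub; [congr ('C(_, _)) |]; lia.
rewrite binS mid natrD; ring.
Qed.

Lemma sum_bin_recurrence u z n :
  (forall k, u k.+2 = u k.+1 - z * u k) ->
  z ^+ n * \sum_(0 <= k < n.+1) 'C(n + k, k)%:R * u k
  = u n - (u n.+2 - z * u n) * \sum_(0 <= k < n) 'C(2 * k + 1, k)%:R * z ^+ k.
Proof.
elim: n u => [|n IHn] u recu.
  by rewrite big_nat1 big_geq // bin0 expr0; ring.
have zT : z * \sum_(0 <= k < n.+2) 'C(n.+1 + k, k)%:R * u k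
    = \sum_(0 <= k < n.+2) 'C(n.+1 + k, k)%:R * (u k.+1 - u k.+2).
  by rewrite mulr_sumr; apply: eq_bigr => k _; rewrite recu; ring.
rewrite exprSr -mulrA zT (sum_bin_diff (fun k => u k.+1)) mulrDr.
rewrite (IHn (fun k => u k.+1)) => [|k]; last exact: recu.
rewrite [in RHS]big_nat_recr //=.
(* The recurrence turns [u n.+2 - 2 * u n.+3] into [- (u n.+3 - z * u n.+1)], the same factor that
   the induction hypothesis for the shifted sequence carries, so it supplies the new last
   summand. *)
rewrite (recu n.+1); ring.
Qed.

End PascalSum.

Section Horadam.
Variables (F : fieldType) (p q : F).
Hypothesis hq : q != 0.
Implicit Types (f g : int -> F) (a b : F) (m s j : int).

Let linrec f := forall j, f (j + 2) = p * f (j + 1) - q * f j.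

(** Two neighbouring values propagate in both directions, backwards because [q] is invertible. *)
Lemma linrec_unique f g : linrec f -> linrec g ->
  f 0 = g 0 -> f 1 = g 1 -> f =1 g.
Proof.
move=> recf recg fg0 fg1.
have pos n : f n%:Z = g n%:Z /\ f n.+1%:Z = g n.+1%:Z.
  elim: n => [//|n [IH0 IH1]]; split=> //.
  have -> : n.+2%:Z = n%:Z + 2 by lia.
  rewrite recf recg -IH0; have -> : n%:Z + 1 = n.+1%:Z by lia.
  by rewrite IH1.
have neg n : f (- n%:Z) = g (- n%:Z) /\ f (- n%:Z + 1) = g (- n%:Z + 1).
  elim: n => [//|n [IH0 IH1]].
  have e1 : - n.+1%:Z + 1 = - n%:Z by lia.
  rewrite e1; split=> //; apply: (mulfI hq).
  have e2 : - n.+1%:Z + 2 = - n%:Z + 1 by lia.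
  have := recf (- n.+1%:Z); have := recg (- n.+1%:Z).
  by rewrite e1 e2 IH0 IH1 => -> /addrI /oppr_inj.
case=> n; first by case: (pos n).
by rewrite NegzE; case: (neg n.+1).
Qed.

Lemma horadam_linrec a b : linrec (horadam a b p q).
Proof.
case=> [n|[|n]].
- have -> : n%:Z + 2 = n.+2%:Z by lia.
  by have -> : n%:Z + 1 = n.+1%:Z by lia.
(* Here [j = -1], where the two one-sided definitions meet. *)
- by rewrite /= mulrA mulfV // mul1r; ring.
- have := @horadam_recN F a b p q n.+2 isT.
  rewrite NegzE => ->; rewrite mulrA mulfV // mul1r; ring.
Qed.

(** The characteristic roots have product [q], so reversing the index and multiplying by [q ^ m]
    swaps them. *)
Lemma linrec_reflect f s : linrec f -> linrec (fun m => q ^ m * f (s - m)).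
Proof.
move=> recf j /=.
have := recf (s - (j + 2)).
have -> : s - (j + 2) + 2 = s - j by lia.
have -> : s - (j + 2) + 1 = s - (j + 1) by lia.
move=> ->; rewrite !expfzDr ?expr1z //; ring.
Qed.

Lemma linrec_shift f s : linrec f -> linrec (fun m => f (s + m)).
Proof. by move=> recf j; rewrite /= (addrA s j 2) (addrA s j 1) recf. Qed.

(** For fixed [s], both sides solve the recurrence in [m], so agreement at [m = 0] and [m = 1]
    suffices. *)
Lemma lucasV_mul f m s : linrec f ->
  lucasV p q m * f s = f (s + m) + q ^ m * f (s - m).
Proof.
move=> recf; move: m; apply: linrec_unique => [j|j||].
- by rewrite /lucasV horadam_linrec; ring.
- by rewrite (linrec_shift s recf) (linrec_reflect s recf); ring.
- by rewrite /= addr0 expr0z; ring.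
- have := recf (s - 1); rewrite subrK.
  have -> : s - 1 + 2 = s + 1 by lia.
  by move=> ->; rewrite /= expr1z; ring.
Qed.

Lemma lucasU_mul f m s : linrec f ->
  lucasU p q m * (f (s + 1) - q * f (s - 1)) = f (s + m) - q ^ m * f (s - m).
Proof.
move=> recf; move: m; apply: linrec_unique => [j|j||].
- by rewrite /lucasU horadam_linrec; ring.
- by rewrite (linrec_shift s recf) (linrec_reflect s recf); ring.
- by rewrite /= addr0 expr0z; ring.
- by rewrite /= expr1z; ring.
Qed.

Lemma linrec_sum_bin f n m t : linrec f -> lucasV p q m != 0 ->
  q ^ (m * n%:Z) *
    (\sum_(0 <= k < n.+1)
       'C(n + k, k)%:R * (f (m * k%:Z + t) / lucasV p q m ^+ k))
  = lucasV p q m ^+ n * f (m * n%:Z + t)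
    - lucasV p q m ^+ n * lucasU p q m *
      (f (m * (n%:Z + 1) + t + 1) - q * f (m * (n%:Z + 1) + t - 1)) *
      (\sum_(0 <= k < n)
         'C(2 * k + 1, k)%:R *
           (q ^ (m * k%:Z) / lucasV p q m ^+ (2 * (k + 1)))).
Proof.
move=> recf; set V := lucasV p q m => V0.
pose u k := f (m * k%:Z + t) / V ^+ k; pose z := q ^ m / V ^+ 2.
have fE k : f (m * k%:Z + t) = V ^+ k * u k.
  by rewrite /u mulrCA mulfV ?expf_neq0 // mulr1.
(* This is [lucasV_mul] centred at [m * (k + 1) + t], divided by [V ^+ k.+2]. *)
have recu k : u k.+2 = u k.+1 - z * u k.
  have := lucasV_mul m (m * k.+1%:Z + t) recf.
  have -> : m * k.+1%:Z + t + m = m * k.+2%:Z + t by lia.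
  have -> : m * k.+1%:Z + t - m = m * k%:Z + t by lia.
  move=> /eqP; rewrite -subr_eq => /eqP; rewrite /u /z => <-.
  by rewrite -/V !exprS; field; rewrite V0 expf_neq0.
(* Centred at [m * (n + 1) + t], the product with [lucasU p q m] becomes
   [V ^+ n.+2 * (u n.+2 - z * u n)]. *)
rewrite -[_ * lucasU p q m * _]mulrA lucasU_mul //.
have -> : m * (n%:Z + 1) + t + m = m * n.+2%:Z + t by lia.
have -> : m * (n%:Z + 1) + t - m = m * n%:Z + t by lia.
have qE k : q ^ (m * k%:Z) = (z * V ^+ 2) ^+ k.
  by rewrite -exprz_exp -exprnP /z divfK ?expf_neq0.
(* The extracted [V ^+ 2] lowers [V ^+ n * V ^+ n.+2] to [V ^+ (2 * n)], the power contained in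
   [q ^ (m * n)]. *)
have -> : \sum_(0 <= k < n) 'C(2 * k + 1, k)%:R *
             (q ^ (m * k%:Z) / V ^+ (2 * (k + 1)))
    = (V ^+ 2)^-1 * \sum_(0 <= k < n) 'C(2 * k + 1, k)%:R * z ^+ k.
  rewrite mulr_sumr; apply: eq_bigr => k _.
  rewrite qE exprM exprD expr1 exprMn; field.
  by rewrite V0 !expf_neq0.
have qm : q ^ m = z * V ^+ 2 by rewrite /z divfK ?expf_neq0.
rewrite qE exprMn qm !fE mulrAC (sum_bin_recurrence n recu).
rewrite -exprM mul2n -addnn exprD !exprS; field.
by rewrite V0.
Qed.

End Horadam.

Theorem theorem15 (R : realType) (a b p q : R[i]) (hp : p != 0) (hq : q != 0)
  (n : nat) (m t : int) (hV : (0 < n)%N -> lucasV p q m != 0) :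
  let W := horadam a b p q in
  let U := lucasU p q in
  let V := lucasV p q in
  q ^ (m * n%:Z) *
    (\sum_(0 <= k < n.+1) 'C(n + k, k)%:R * (W (m * k%:Z + t) / V m ^+ k))
  = V m ^+ n * W (m * n%:Z + t)
    - V m ^+ n * U m *
      (W (m * (n%:Z + 1) + t + 1) - q * W (m * (n%:Z + 1) + t - 1)) *
      (\sum_(0 <= k < n)
         'C(2 * k + 1, k)%:R * (q ^ (m * k%:Z) / V m ^+ (2 * (k + 1)))).
Proof.
move=> W U V.
(* For [n = 0] only the zeroth power of [V m] occurs and both sides are [W t]. *)
case: n hV => [_|n /(_ isT) V0].
  by rewrite big_nat1 big_geq // !mulr0 expr0z expr0 bin0 divr1 !mul1r subr0.
by apply: linrec_sum_bin => //; exact: horadam_linrec.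
Qed.
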